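(* Consider the SWEMED1 system with transport matrix $A(W)$ and the split source $S_\delta(W)=S^{\mathrm{fast}}(W)+\delta\,S^{\mathrm{slow}}(W)$ given in the context, at the fast suspended water-at-rest manifold $\mathcal M_0=\{W\in G:\ u_m=0,\ \alpha_1=0,\ c_m>0\}$ obtained from the fast limit $\delta\to0$. Then, at every $W\in\mathcal M_0$, Yong's condition (I) holds for the fast source $S^{\mathrm{fast}}$, whereas Yong's condition (II) fails for $A$ (there is no symmetric positive definite $A_0(W)$ with $A_0(W)A(W)=A(W)^TA_0(W)$). Consequently, the full set of Yong's structural stability conditions (I)-(III) cannot be verified at this manifold, i.e. they do not hold simultaneously.
   Context: The state is $W=(h,hu_m,h\alpha_1,hc_m,h_b)^T\in\mathbb R^5$, where $h$ is the water height, $u_m$ the mean velocity, $\alpha_1$ the first velocity-moment coefficient, $c_m$ the depth-averaged suspended sediment concentration and $h_b$ the bed elevation. The admissible set is $G=\{W: h>0,\ 0\le c_m\le1\}$ (the formulas below make sense in a neighbourhood of $G$, so Jacobians are defined on $G$). The bottom velocity is $u_b=u_m+\alpha_1$ and the mixture density is $\rho=\rho_w+c_m(\rho_s-\rho_w)$. Transport matrix: $$A(W)=\begin{pmatrix}0&1&0&0&0\\ gh-u_m^2-\frac{\alpha_1^2}{3}-\frac{ghc_m(\rho_s-\rho_w)}{2\rho}&2u_m&\frac{2\alpha_1}{3}&\frac{gh(\rho_s-\rho_w)}{2\rho}&gh\\ -2\alpha_1u_m-\frac{ghc_m(\rho_s-\rho_w)}{2\rho}&2\alpha_1&u_m&\frac{gh(\rho_s-\rho_w)}{2\rho}&0\\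 -c_mu_m&c_m&0&u_m&0\\ \delta_h&\delta_q&\delta_q&\delta_c&0\end{pmatrix},$$ $$\delta_q=\frac{24Q}{1-\psi}\operatorname{sgn}(u_b)\frac{\rho\epsilon}{g(\rho_s-\rho_w)d_s}(\theta-\theta_c)_+^{1/2}\frac{u_b}{h},\quad \delta_h=-u_b\left(1+\frac{c_m(\rho_s-\rho_w)}{2\rho}\right)\delta_q,\quad \delta_c=u_b\frac{\rho_s-\rho_w}{2\rho}\delta_q,$$ where $\theta=\frac{\rho\epsilon u_b^2}{g(\rho_s-\rho_w)d_s}$ is the Shields parameter, $(\cdot)_+$ the positive part, $\theta_c\ge0$ the critical Shields parameter, and $Q>0$ a constant. Split source: $$S^{\mathrm{fast}}(W)=\begin{pmatrix}\frac{E}{1-\psi}\\ -\mu u_b+\frac{E}{1-\psi}u_b\\ -3\left(\mu u_b+4\frac{\nu}{h}\alpha_1\right)+2\frac{E}{1-\psi}\alpha_1\\ E\\ -\frac{E}{1-\psi}\end{pmatrix},\qquad S^{\mathrm{slow}}(W)=\begin{pmatrix}-\frac{D}{1-\psi}\\ -\frac{D}{1-\psi}u_b\\ -2\frac{D}{1-\psi}\alpha_1\\ -D\\ \frac{D}{1-\psi}\end{pmatrix},$$ with $E=\omega_0(1-\psi)E_s$, $D=\omega_0S_bc_m$, $$E_s=\frac{1.3\times10^{-7}\mathcal Z^5}{1+4.3\times10^{-7}\mathcal Z^5},\qquad \mathcal Z=\frac{\gamma_1\sqrt{c_D}\,|u_b|}{\omega_0}\mathcal R_p^{\gamma_2}.$$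 Constants: $g,\epsilon,\mu,\nu,d_s,\omega_0,S_b,c_D,\mathcal R_p>0$, $\rho_s>\rho_w>0$, $\psi\in[0,1)$; $(\gamma_1,\gamma_2)=(1,0.6)$ if $\mathcal R_p>2.36$ and $(0.586,1.23)$ if $\mathcal R_p\le2.36$. Yong's structural stability conditions at a state $W$, here with source Jacobian $S_W=\partial S^{\mathrm{fast}}/\partial W$: (I) (block condition) There are an invertible matrix $P(W)$, an integer $r$ and an invertible $r\times r$ matrix $\widehat T(W)$ with $P(W)S_W(W)P(W)^{-1}=\begin{pmatrix}0&0\\0&\widehat T(W)\end{pmatrix}$. (II) (transport symmetrization) There is a symmetric positive definite $A_0(W)$ with $A_0(W)A(W)=A(W)^TA_0(W)$. (III) (dissipation compatibility) With $A_0(W)$ as in (II) and $P(W)$, $r$ as in (I), $A_0(W)S_W(W)+S_W(W)^TA_0(W)\preceq -P(W)^T\begin{pmatrix}0&0\\0&I_r\end{pmatrix}P(W)$, where $\preceq$ is the Loewner order on symmetric matrices. *)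

(* Defs.v *)
From mathcomp Require Import all_boot all_order all_algebra.
From mathcomp Require Import all_classical all_reals all_analysis.
From mathcomp Require Import ring lra.

Set Implicit Arguments.
Unset Strict Implicit.
Unset Printing Implicit Defensive.

Import Order.TTheory GRing.Theory Num.Theory.
Import numFieldNormedType.Exports.

Local Open Scope classical_set_scope.
Local Open Scope ring_scope.

Section Stability.
Context {R : realType}.

Definition spd n (A : 'M[R]_n) : Prop :=
  A^T = A /\ forall v : 'rV[R]_n, v != 0 -> 0 < (v *m A *m v^T) 0 0.

Definition loewner_le n (A B : 'M[R]_n) : Prop :=
  [/\ A^T = A, B^T = B & forall v : 'rV[R]_n, 0 <= (v *m (B - A) *m v^T) 0 0].

(* The n x n matrix with diagonal blocks 0 (of size n - r) and T. *)
Definition corner_mx n r (le_rn : (r <= n)%N) (T : 'M[R]_r) : 'M[R]_n :=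
  castmx (subnK le_rn, subnK le_rn) (block_mx (0 : 'M[R]_(n - r)) 0 0 T).

(* The library's ['J f W] acts on row vectors, v |-> v *m 'J f W; the usual
   matrix of partial derivatives (d f_i / d W_j)_(i, j) is its transpose.
   ['J f W] is meaningful only where f is differentiable, as [source_fast]
   below is, for physical parameters, at every state with h <> 0. *)
Definition jacobian_mx m n (f : 'rV[R]_n -> 'rV[R]_m) (W : 'rV[R]_n) :
  'M[R]_(m, n) := ('J f W)^T.

Definition block_form n (S : 'M[R]_n) r (le_rn : (r <= n)%N) (P : 'M[R]_n)
    : Prop :=
  P \in unitmx /\
  exists2 T : 'M[R]_r, T \in unitmx & P *m S *m invmx P = corner_mx le_rn T.

Definition symmetrizer n (A A0 : 'M[R]_n) : Prop :=
  spd A0 /\ A0 *m A = A^T *m A0.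

Definition dissipative n (S A0 : 'M[R]_n) r (le_rn : (r <= n)%N) (P : 'M[R]_n)
    : Prop :=
  loewner_le (A0 *m S + S^T *m A0) (- (P^T *m corner_mx le_rn 1%:M *m P)).

(* Yong's conditions (I), (II) and (I)-(III) together at one state, for the
   transport matrix A and the source Jacobian S at that state. *)
Definition yongI n (S : 'M[R]_n) : Prop :=
  exists r (le_rn : (r <= n)%N) P, block_form S le_rn P.

Definition yongII n (A : 'M[R]_n) : Prop := exists A0, symmetrizer A A0.

Definition yong_stability n (A S : 'M[R]_n) : Prop :=
  exists r (le_rn : (r <= n)%N) P A0,
    [/\ block_form S le_rn P, symmetrizer A A0 & dissipative S A0 le_rn P].

End Stability.

Record swemed_params (R : realType) := SwemedParams {
  grav : R;     (* g *)
  epsn : R;     (* epsilon *)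
  mu : R;
  nu : R;
  dsed : R;     (* d_s *)
  omega0 : R;
  Sb : R;
  cD : R;
  Rp : R;
  rhow : R;
  rhos : R;
  psi : R;
  thetac : R;
  Q : R
}.

Record physical (R : realType) (p : swemed_params R) : Prop := Physical {
  grav_gt0 : 0 < grav p;
  epsn_gt0 : 0 < epsn p;
  mu_gt0 : 0 < mu p;
  nu_gt0 : 0 < nu p;
  dsed_gt0 : 0 < dsed p;
  omega0_gt0 : 0 < omega0 p;
  Sb_gt0 : 0 < Sb p;
  cD_gt0 : 0 < cD p;
  Rp_gt0 : 0 < Rp p;
  rhow_gt0 : 0 < rhow p;
  rhow_lt_rhos : rhow p < rhos p;
  psi_ge0 : 0 <= psi p;
  psi_lt1 : psi p < 1;
  thetac_ge0 : 0 <= thetac p;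
  Q_gt0 : 0 < Q p
}.

Section Swemed.
Context {R : realType}.
Implicit Types (p : swemed_params R) (W : 'rV[R]_5).

(* A state is the row vector W = (h, h u_m, h alpha_1, h c_m, h_b). *)
Definition height W : R := W 0 0.
Definition um W : R := W 0 1 / height W.
Definition alpha1 W : R := W 0 2 / height W.
Definition cm W : R := W 0 3 / height W.

Definition admissible : set 'rV[R]_5 :=
  [set W | 0 < height W /\ 0 <= cm W <= 1].

Definition rest_manifold : set 'rV[R]_5 :=
  [set W | [/\ admissible W, um W = 0, alpha1 W = 0 & 0 < cm W]].

Definition ub W : R := um W + alpha1 W.

Definition rho p W : R := rhow p + cm W * (rhos p - rhow p).

Definition shields p W : R :=
  rho p W * epsn p * ub W ^+ 2 / (grav p * (rhos p - rhow p) * dsed p).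

Definition delta_q p W : R :=
  24 * Q p / (1 - psi p) * Num.sg (ub W)
  * (rho p W * epsn p / (grav p * (rhos p - rhow p) * dsed p))
  * Num.sqrt (Num.max (shields p W - thetac p) 0) * (ub W / height W).

Definition delta_h p W : R :=
  - ub W * (1 + cm W * (rhos p - rhow p) / (2 * rho p W)) * delta_q p W.

Definition delta_c p W : R :=
  ub W * ((rhos p - rhow p) / (2 * rho p W)) * delta_q p W.

Definition transport p W : 'M[R]_5 :=
  let g := grav p in let h := height W in
  let u := um W in let a := alpha1 W in let c := cm W in
  let k := g * h * (rhos p - rhow p) / (2 * rho p W) in
  let kc := g * h * c * (rhos p - rhow p) / (2 * rho p W) in
  \matrix_(i < 5, j < 5) (nth [::]
    [:: [:: 0;                                1;   0;         0; 0];
        [:: g * h - u ^+ 2 - a ^+ 2 / 3 - kc; 2 * u; 2 * a / 3; k; g * h];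
        [:: - (2 * a * u) - kc;               2 * a; u;         k; 0];
        [:: - (c * u);                        c;   0;         u; 0];
        [:: delta_h p W; delta_q p W; delta_q p W; delta_c p W; 0]] i)`_j.

Definition gamma1 p : R := if 236 / 100 < Rp p then 1 else 586 / 1000.
Definition gamma2 p : R := if 236 / 100 < Rp p then 6 / 10 else 123 / 100.

Definition Zed p W : R :=
  gamma1 p * Num.sqrt (cD p) * `|ub W| / omega0 p * Rp p `^ gamma2 p.

(* 13 / 10 ^+ 8 = 1.3e-7 and 43 / 10 ^+ 8 = 4.3e-7 *)
Definition Es p W : R :=
  13 / 10 ^+ 8 * Zed p W ^+ 5 / (1 + 43 / 10 ^+ 8 * Zed p W ^+ 5).

Definition erosion p W : R := omega0 p * (1 - psi p) * Es p W.
Definition deposition p W : R := omega0 p * Sb p * cm W.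

Definition source_fast p W : 'rV[R]_5 :=
  let E' := erosion p W / (1 - psi p) in
  \row_(j < 5)
    [:: E';
        - (mu p * ub W) + E' * ub W;
        - (3 * (mu p * ub W + 4 * (nu p / height W) * alpha1 W))
          + 2 * E' * alpha1 W;
        erosion p W;
        - E']`_j.

Definition source_slow p W : 'rV[R]_5 :=
  let D' := deposition p W / (1 - psi p) in
  \row_(j < 5)
    [:: - D'; - (D' * ub W); - (2 * D' * alpha1 W); - deposition p W; D']`_j.

Definition source p (delta : R) W : 'rV[R]_5 :=
  source_fast p W + delta *: source_slow p W.

(* The fast source is the limit of the split source as delta -> 0, ... *)
Lemma source_cvg_fast p W : source p delta W @[delta --> 0] --> source_fast p W.
Proof.
rewrite -[X in _ --> X]addr0 -(scale0r (source_slow p W)).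
by apply: cvgD; [exact: cvg_cst | apply: cvgZr_tmp; exact: cvg_id].
Qed.

Lemma erosion_eq0 p W : physical p -> (erosion p W == 0) = (ub W == 0).
Proof.
move=> hp; have w0 := omega0_gt0 hp; have cd0 := cD_gt0 hp.
have rp0 : 0 < Rp p `^ gamma2 p by rewrite powR_gt0 // Rp_gt0.
have g1 : 0 < gamma1 p by rewrite /gamma1; case: ifP => _; lra.
have psi1 := psi_lt1 hp.
have Z0 : 0 <= Zed p W.
  by rewrite /Zed !mulr_ge0 ?invr_ge0 ?sqrtr_ge0 // ltW.
have D0 : 0 < 1 + 43 / 10 ^+ 8 * Zed p W ^+ 5.
  by apply: ltr_wpDr => //; rewrite mulr_ge0 // exprn_ge0.
have c0 : 0 < 13 / 10 ^+ 8 :> R by rewrite divr_gt0 // exprn_gt0.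
have psi0 : 0 < 1 - psi p by lra.
have sq0 : 0 < Num.sqrt (cD p) by rewrite sqrtr_gt0.
rewrite /erosion /Es mulf_eq0 (gt_eqF (mulr_gt0 w0 psi0)) /= mulf_eq0.
rewrite invr_eq0 (gt_eqF D0) orbF mulf_eq0 (gt_eqF c0) /= expf_eq0.
rewrite /= /Zed !mulf_eq0 invr_eq0 normr_eq0.
by rewrite (gt_eqF g1) (gt_eqF sq0) (gt_eqF w0) (gt_eqF rp0) !orbF.
Qed.

(* ... and, off c_m = 0, the rest manifold is its equilibrium manifold. *)
Lemma rest_manifoldE p : physical p ->
  rest_manifold =
  [set W | [/\ admissible W, 0 < cm W & source_fast p W = 0]].
Proof.
move=> hp; apply/seteqP; split=> W /=.
  move=> [aW u0 a0 c0]; split => //.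
  have b0 : ub W = 0 by rewrite /ub u0 a0 addr0.
  have /eqP E0 : erosion p W == 0 by rewrite erosion_eq0 // b0.
  apply/rowP => j; rewrite !mxE b0 a0 E0.
  by case: j => [[|[|[|[|[|//]]]]]] hj /=; rewrite ?(mul0r, mulr0, oppr0, addr0).
move=> [aW c0 /rowP S0]; have h0 := aW.1.
have := S0 3; rewrite !mxE /= => /eqP; rewrite erosion_eq0 // => /eqP b0.
have /eqP E0 : erosion p W == 0 by rewrite erosion_eq0 // b0.
have := S0 2; rewrite !mxE /= E0 b0 !(mul0r, mulr0, add0r, addr0) => /eqP.
have nu0 := nu_gt0 hp.
rewrite oppr_eq0 !mulf_eq0 !invr_eq0 (gt_eqF h0) (gt_eqF nu0) /=.
have -> : (3 == 0 :> R) = false by apply/negP => /eqP; lra.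
have -> : (4 == 0 :> R) = false by apply/negP => /eqP; lra.
rewrite /= orbF => /eqP W20; have a0 : alpha1 W = 0 by rewrite /alpha1 W20 mul0r.
split => //.
by move: b0; rewrite /ub a0 addr0.
Qed.

End Swemed.

(* Main.v *)
From HB Require Import structures.
Require Import Defs.
From mathcomp Require Import all_boot all_order all_algebra.
From mathcomp Require Import all_classical all_reals all_analysis.
From mathcomp Require Import ring lra.
From mathcomp Require Import perm.

(** Condition (II) fails because of a Jordan block.  At rest, sgn(u_b) u_b = 0
    kills the whole bed-load row of the transport matrix, and what remains has
    rank 3 while its square has rank 2.  A matrix with a symmetrizer is
    self-adjoint for the inner product A0, so its kernel equals the kernel of
    its square ([symmetrizer_ker_sqr]).  An explicit vector, combining a change
    of depth with the change of bed level that balances its pressure, is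
    annihilated by A^2 but sent by A to a non-zero multiple of c_m along the
    moment equation; this is where c_m > 0 is essential
    ([transport_not_symmetrizable]).

    Condition (I) holds because the linearized fast source only sees friction
    and viscosity.  The erosion rate E contains the non-smooth factor |u_b|^5,
    and the source is differentiated without differentiating this factor: every
    term of the source has a factor h u_b or h alpha_1, which are linear in the
    state and vanish at rest, times something continuous
    ([source_fast_split]).  The product of a vanishing linear form and a
    continuous function is differentiable, with differential obtained by
    freezing the continuous factor ([is_diff_scale_vanishing]).  Since
    E / (h u_b) is still of order u_b^4, erosion drops out, and the Jacobian is
    supported on the 2 x 2 block of the velocity and moment equations, whose
    determinant 12 mu nu / h^3 is positive.  A permutation of coordinates brings that block
    into the lower right corner ([yongI_rest]).

    The three conditions together contain (II), hence fail with it. *)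

Set Implicit Arguments.
Unset Strict Implicit.
Unset Printing Implicit Defensive.

Import Order.TTheory GRing.Theory Num.Theory.
Import numFieldNormedType.Exports.

Local Open Scope classical_set_scope.
Local Open Scope ring_scope.

(** * Self-adjointness and differentiation of products *)

(** [A] is self-adjoint for the inner product [A0], so that
    <A x, A x> = <x, A (A x)>: a symmetrizable matrix has no nilpotent Jordan
    block of size at least 2. *)
Lemma symmetrizer_ker_sqr (R : realType) n (A A0 : 'M[R]_n) (x : 'cV[R]_n) :
  symmetrizer A A0 -> A *m (A *m x) = 0 -> A *m x = 0.
Proof.
move=> [[_ A0gt0] A0A] AAx; apply/eqP/negPn/negP => Ax0.
have : (A *m x)^T != 0 by rewrite -(inj_eq trmx_inj) trmxK trmx0.
move=> /A0gt0; rewrite trmxK trmx_mul -!mulmxA (mulmxA _ A0) -A0A -mulmxA AAx.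
by rewrite !mulmx0 mxE ltxx.
Qed.

(** The increment of [l *: g] at a zero of [l] is [l v *: g (x + v)], and
    replacing [g (x + v)] by [g x] costs only [O(v) * o(1)].  Mere continuity of
    [g] suffices, which lets non-smooth factors be treated on a par with smooth
    ones. *)
Lemma is_diff_scale_vanishing (R : realType)
    (V W : normedModType R) (l : {linear V -> R}) (g : V -> W) (x : V) :
  continuous l -> l x = 0 -> {for x, continuous g} ->
  is_diff x (fun y => l y *: g y) (fun v => l v *: g x).
Proof.
move=> lc lx0 gc.
have dl : linear (fun v => l v *: g x).
  by move=> a u v; rewrite linearP scalerDl scalerA.
pose dM := GRing.isLinear.Build _ _ _ _ _ dl.
pose d : {linear V -> W} := HB.pack (fun v => l v *: g x) dM.
have dc : continuous d by move=> v; apply: cvgZr_tmp; exact: lc.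
have dE : (fun y => l y *: g y) \o shift x =
    cst (l x *: g x) + d +o_ (0 : V) id.
  apply/eqaddoP => _/posnumP[e].
  have [k k0 lk] := linear_lipschitz lc.
  have ek0 : 0 < e%:num / k by rewrite divr_gt0.
  have gx0 : \forall h \near (0 : V), `|g x - g (h + x)| < e%:num / k.
    have /cvgrPdist_lt/(_ _ ek0) := gc.
    by rewrite [X in X -> _](near_shift 0) subr0.
  near=> h.
  rewrite /= !fctE /= /d /= lx0 scale0r add0r linearD lx0 addr0 -scalerBr.
  rewrite normrZ (le_trans (ler_wpM2r _ (lk h)))// mulrAC ler_wpM2r//.
  rewrite mulrC -ler_pdivlMr// distrC ltW//.
  by near: h.
apply: DiffDef; last by rewrite (diff_unique dc dE).
by apply/diff_locallyP; rewrite (diff_unique dc dE).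
Unshelve. all: by end_near. Qed.

Lemma cvg_row (R : realType) (T : Type) (F : set_system T) {FF : Filter F} n
    (f : T -> 'I_n -> R) (l : 'I_n -> R) :
  (forall j, f t j @[t --> F] --> l j) ->
  \row_j f t j @[t --> F] --> \row_j l j.
Proof.
move=> fl; apply/cvgrPdist_lt => e e0.
have fle : \forall t \near F, forall j, `|l j - f t j| < e.
  by apply: filter_forall => j; have /cvgrPdist_lt/(_ _ e0) := fl j.
apply: filterS fle => t fte.
rewrite /Num.Def.normr/= mx_normrE (bigmax_lt _ e0)//= => -[i j] _.
by rewrite !mxE.
Qed.

Section Swemed.
Context {R : realType}.
Implicit Types (p : swemed_params R) (W : 'rV[R]_5).

(** * Failure of the transport symmetrization *)

Lemma transport_not_symmetrizable p W : physical p -> rest_manifold W ->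
  ~ yongII (transport p W).
Proof.
move=> hp [[h0 _] u0 a0 c0] [A0 symA].
(* Raising the depth by 1 while shifting the bed so that the momentum row of
   A vanishes; only the moment row, which does not see the bed, reacts. *)
pose x : 'cV[R]_5 := \col_i
  [:: 1; 0; 0; 0; cm W * (rhos p - rhow p) / (2 * rho p W) - 1]`_i.
pose y : 'cV[R]_5 := \col_i
  [:: 0; 0; - (grav p * height W * cm W * (rhos p - rhow p) / (2 * rho p W)); 0;
      0]`_i.
have g0 := grav_gt0 hp; have rw0 := rhow_gt0 hp; have drho := rhow_lt_rhos hp.
have rho0 : 0 < rho p W by rewrite /rho; nra.
have ub0 : ub W = 0 by rewrite /ub u0 a0 addr0.
have dq : delta_q p W = 0 by rewrite /delta_q ub0 sgr0 !(mulr0, mul0r).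
have dh : delta_h p W = 0 by rewrite /delta_h dq mulr0.
have dc : delta_c p W = 0 by rewrite /delta_c dq mulr0.
have Ax : transport p W *m x = y.
  apply/colP => i; rewrite !mxE !big_ord_recl big_ord0 !mxE /= dh dq dc u0 a0.
  by case: i => [[|[|[|[|[|//]]]]]] hi /=; field; exact: lt0r_neq0.
have Ay : transport p W *m y = 0.
  apply/colP => i; rewrite !mxE !big_ord_recl big_ord0 !mxE /= dh dq dc u0 a0.
  by case: i => [[|[|[|[|[|//]]]]]] hi /=; ring.
have : y = 0 by rewrite -Ax; apply: (symmetrizer_ker_sqr symA); rewrite Ax.
move=> /colP /(_ 2).
rewrite !mxE /=; apply/eqP; rewrite oppr_eq0 lt0r_neq0//.
apply: divr_gt0; last by rewrite mulr_gt0.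
by rewrite mulr_gt0 ?subr_gt0// mulr_gt0// mulr_gt0.
Qed.

(** * Linearization of the fast source *)

Definition bottom_momentum (W : 'rV[R]_5) : R := W 0 1 + W 0 2.

Definition moment1 (W : 'rV[R]_5) : R := W 0 2.

Lemma bottom_momentum_linear : linear bottom_momentum.
Proof. by move=> a u v; rewrite /bottom_momentum !mxE scalerDr addrACA. Qed.

HB.instance Definition _ :=
  GRing.isLinear.Build R 'rV[R]_5 R _ bottom_momentum bottom_momentum_linear.

Lemma moment1_linear : linear moment1.
Proof. by move=> a u v; rewrite /moment1 !mxE. Qed.

HB.instance Definition _ :=
  GRing.isLinear.Build R 'rV[R]_5 R _ moment1 moment1_linear.

Lemma bottom_momentum_continuous : continuous bottom_momentum.
Proof.
move=> W; apply: (@continuousD _ _ _ (fun V : 'rV[R]_5 => V 0 1)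
                                     (fun V => V 0 2)).
  exact: (@coord_continuous _ _ _ 0 1).
exact: (@coord_continuous _ _ _ 0 2).
Qed.

Lemma moment1_continuous : continuous moment1.
Proof. exact: (@coord_continuous _ _ _ 0 2). Qed.

Lemma ubE W : ub W = bottom_momentum W / height W.
Proof. by rewrite /ub /um /alpha1 /bottom_momentum mulrDl. Qed.

(** The quotient E / (h u_b), given the value 0 at u_b = 0: the factor |u_b|^5
    of E is written as |u_b|^3 u_b times (h u_b) / h, and h u_b is dropped. *)
Definition erosion_factor p W : R :=
  omega0 p * (1 - psi p) * (13 / 10 ^+ 8) *
  (gamma1 p * Num.sqrt (cD p) / omega0 p * Rp p `^ gamma2 p) ^+ 5 *
  (`|ub W| ^+ 3 * ub W / height W) / (1 + 43 / 10 ^+ 8 * Zed p W ^+ 5).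

Lemma erosionE p W : erosion p W = bottom_momentum W * erosion_factor p W.
Proof.
rewrite /erosion_factor /erosion /Es.
have -> : Zed p W ^+ 5 =
    (gamma1 p * Num.sqrt (cD p) / omega0 p * Rp p `^ gamma2 p) ^+ 5 *
    (bottom_momentum W * (`|ub W| ^+ 3 * ub W / height W)).
  rewrite (_ : bottom_momentum W * _ = `|ub W| ^+ 3 * ub W ^+ 2); last first.
    by rewrite expr2 {4}ubE; ring.
  by rewrite -(real_normK (num_real (ub W))) -exprD -exprMn; congr (_ ^+ 5);
     rewrite /Zed; ring.
by ring.
Qed.

Definition bottom_momentum_coef p V (j : 'I_5) : R :=
  [:: erosion_factor p V / (1 - psi p);
      - (mu p / height V) + erosion_factor p V / (1 - psi p) * ub V;
      - (3 * (mu p / height V))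
        + 2 * (erosion_factor p V / (1 - psi p)) * alpha1 V;
      erosion_factor p V;
      - (erosion_factor p V / (1 - psi p))]`_j.

Definition moment1_coef p V (j : 'I_5) : R :=
  [:: 0; 0; - (12 * nu p / height V / height V); 0; 0]`_j.

(** This form isolates all the non-smoothness in factors that only need to be
    continuous, multiplied by linear forms that vanish at rest. *)
Lemma source_fast_split p : source_fast p =
  (fun V => bottom_momentum V *: \row_j bottom_momentum_coef p V j)
  + (fun V => moment1 V *: \row_j moment1_coef p V j).
Proof.
apply/funext => V; apply/rowP => j; rewrite !fctE !mxE erosionE.
case: j => [[|[|[|[|[|//]]]]]] hj;
  rewrite /bottom_momentum_coef /moment1_coef /= ?ubE /alpha1 /moment1; ring.
Qed.

(** The limits are taken along an arbitrary filter [F] finer than the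
    neighbourhoods of [W]; keeping [F] abstract prevents unification from
    unfolding the neighbourhoods of a matrix. *)
Section Limits.
Context (F : set_system 'rV[R]_5) {FF : Filter F} (W : 'rV[R]_5) (FW : F --> W).

Lemma cvg_coord (j : 'I_5) : (V : 'rV[R]_5) 0 j @[V --> F] --> W 0 j.
Proof. exact: (cvg_comp _ _ FW (@coord_continuous R 1 5 0 j W)). Qed.

Lemma cvg_heightV : height W != 0 -> (height V)^-1 @[V --> F] --> (height W)^-1.
Proof. by move=> h0; apply: cvgV => //; exact: (cvg_coord (j := 0)). Qed.

Lemma cvg_div_height (j : 'I_5) : height W != 0 ->
  (V : 'rV[R]_5) 0 j / height V @[V --> F] --> W 0 j / height W.
Proof.
by move=> h0; apply: cvgM; [exact: cvg_coord|exact: cvg_heightV].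
Qed.

Lemma cvg_ub : height W != 0 -> ub V @[V --> F] --> ub W.
Proof. by move=> h0; apply: cvgD; exact: cvg_div_height. Qed.

Lemma cvg_exp (f : 'rV[R]_5 -> R) (a : R) n :
  f V @[V --> F] --> a -> f V ^+ n @[V --> F] --> a ^+ n.
Proof. by move=> fc; exact: (cvg_comp _ _ fc (@exprn_continuous R n a)). Qed.

Lemma cvg_erosion_factor p : height W != 0 -> ub W = 0 ->
  erosion_factor p V @[V --> F] --> erosion_factor p W.
Proof.
move=> h0 u0; have uc := cvg_ub h0.
have nc : `|ub V| @[V --> F] --> `|ub W| by exact: cvg_norm.
have Zc : Zed p V @[V --> F] --> Zed p W.
  by apply: cvgMr_tmp; apply: cvgMr_tmp; exact: cvgMl_tmp.
apply: cvgM.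
  apply: cvgMl_tmp; apply: cvgM; last exact: cvg_heightV.
  by apply: cvgM => //; exact: cvg_exp.
apply: cvgV; last first.
  by apply: cvgD; [exact: cvg_cst|apply: cvgMl_tmp; exact: cvg_exp].
by rewrite /Zed u0 normr0 mulr0 !mul0r expr0n/= mulr0 addr0 oner_neq0.
Qed.

Lemma cvg_bottom_momentum_coef p : height W != 0 -> ub W = 0 ->
  \row_j bottom_momentum_coef p V j @[V --> F] -->
  \row_j bottom_momentum_coef p W j.
Proof.
move=> h0 u0; have hc := cvg_heightV h0; have uc := cvg_ub h0.
have ac := cvg_div_height (j := 2) h0.
have ec := cvg_erosion_factor (p := p) h0 u0.
apply: cvg_row => -[[|[|[|[|[|//]]]]]] hj; rewrite /bottom_momentum_coef /=.
- exact: cvgMr_tmp.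
- apply: cvgD; first by apply: cvgN; exact: cvgMl_tmp.
  by apply: cvgM => //; exact: cvgMr_tmp.
- apply: cvgD; first by apply: cvgN; apply: cvgMl_tmp; exact: cvgMl_tmp.
  by apply: cvgM => //; apply: cvgMl_tmp; exact: cvgMr_tmp.
- exact: ec.
- by apply: cvgN; exact: cvgMr_tmp.
Qed.

Lemma cvg_moment1_coef p : height W != 0 ->
  \row_j moment1_coef p V j @[V --> F] --> \row_j moment1_coef p W j.
Proof.
move=> h0; have hc := cvg_heightV h0.
apply: cvg_row => -[[|[|[|[|[|//]]]]]] hj; rewrite /moment1_coef /=;
  try exact: cvg_cst.
by apply: cvgN; apply: cvgM => //; exact: cvgMl_tmp.
Qed.

End Limits.

(** Only the values of the two coefficient rows at [W] enter: the erosion factor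
    vanishes there, which leaves friction and viscosity. *)
Lemma jacobian_source_fast_rest p W : rest_manifold W ->
  jacobian_mx (source_fast p) W = \matrix_(i < 5, j < 5) (nth [::]
    [:: nseq 5 0;
        [:: 0; - (mu p / height W); - (mu p / height W); 0; 0];
        [:: 0; - (3 * (mu p / height W));
            - (3 * (mu p / height W)) - 12 * nu p / height W / height W; 0; 0];
        nseq 5 0; nseq 5 0] i)`_j.
Proof.
move=> [[/lt0r_neq0 h0 _] u0 a0 _].
have ub0 : ub W = 0 by rewrite /ub u0 a0 addr0.
have ef0 : erosion_factor p W = 0.
  by rewrite /erosion_factor ub0 !(mulr0, mul0r).
have m10 : moment1 W = 0.
  by apply/eqP; move/eqP: a0; rewrite mulf_eq0 invr_eq0 (negPf h0) orbF.
have m0 : bottom_momentum W = 0.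
  by apply/eqP; move/eqP: ub0; rewrite ubE mulf_eq0 invr_eq0 (negPf h0) orbF.
have bmc : {for W, continuous (fun V => \row_j bottom_momentum_coef p V j)}.
  exact: (cvg_bottom_momentum_coef (cvg_id (F := nbhs W)) h0 ub0).
have m1c : {for W, continuous (fun V => \row_j moment1_coef p V j)}.
  exact: (cvg_moment1_coef (cvg_id (F := nbhs W)) h0).
have D1 := is_diff_scale_vanishing bottom_momentum_continuous m0 bmc.
have D2 := is_diff_scale_vanishing moment1_continuous m10 m1c.
have D := is_diffD D1 D2; rewrite -source_fast_split in D.
apply/matrixP => i j.
transitivity ('d (source_fast p) W (delta_mx 0 j) 0 i).
  by rewrite /jacobian_mx /jacobian !mxE.
rewrite diff_val !fctE !mxE /=.
rewrite /bottom_momentum /moment1 !mxE /bottom_momentum_coef /moment1_coef.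
rewrite ef0 ub0 a0.
case: i => [[|[|[|[|[|//]]]]]] hi; case: j => [[|[|[|[|[|//]]]]]] hj /=; ring.
Qed.

(** * The block condition *)

Lemma yongI_rest p W : physical p -> rest_manifold W ->
  yongI (jacobian_mx (source_fast p) W).
Proof.
move=> hp hW; rewrite jacobian_source_fast_rest//.
have [[h0 _] _ _ _] := hW; have mu0 := mu_gt0 hp; have nu0 := nu_gt0 hp.
(* Exchanging indices 1, 2 with 3, 4 moves the block of the velocity and moment
   equations to the lower right corner. *)
pose s : 'S_5 := (tperm (1 : 'I_5)%R 3%R * tperm 2%R 4%R)%g.
pose T : 'M[R]_2 := \matrix_(i < 2, j < 2) (nth [::]
  [:: [:: - (mu p / height W); - (mu p / height W)];
      [:: - (3 * (mu p / height W));
          - (3 * (mu p / height W)) - 12 * nu p / height W / height W]] i)`_j.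
exists 2%N, (isT : (2 <= 5)%N), (perm_mx s); split; first exact: unitmx_perm.
exists T.
  rewrite unitmxE unitfE (expand_det_row _ 0) !big_ord_recl big_ord0.
  rewrite /cofactor !det_mx11 !mxE /=.
  rewrite (_ : _ + _ = 12 * (mu p / height W) * (nu p / height W / height W)).
    by rewrite lt0r_neq0// !(mulr_gt0, invr_gt0).
  by rewrite /bump /=; ring.
rewrite -[invmx _]/((perm_mx s)^-1) -perm_mxV -row_permE -col_permE.
have sE i : s i = [:: 0; 3; 4; 1; 2]`_i :> nat.
  rewrite permM !permE /=.
  by case: i => [[|[|[|[|[|//]]]]]] hi.
apply/matrixP => i j; rewrite /corner_mx castmx_id !mxE !sE.
case: splitP => k ->; rewrite mxE; case: splitP => l ->; rewrite !mxE;
  by case: k => [[|[|[|//]]]] hk; case: l => [[|[|[|//]]]] hl.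
Qed.

End Swemed.

Theorem theorem4 (R : realType) (p : swemed_params R) (hp : physical p)
    (W : 'rV[R]_5) (hW : rest_manifold W) :
  let A := transport p W in
  let S := jacobian_mx (source_fast p) W in
  [/\ yongI S, ~ yongII A & ~ yong_stability A S].
Proof.
have nII := transport_not_symmetrizable hp hW.
split=> //; first exact: yongI_rest.
by move=> [r [le_r5 [P [A0 [_ symA0 _]]]]]; apply: nII; exists A0.
Qed.
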